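(* There is a nonempty Zariski-open set $\mathcal U\subset\mathbb{R}^{3\times 3}$, which is also Euclidean-open and dense, such that $$\operatorname{spec}(A_J)\cap\operatorname{spec}(A_K)=\varnothing$$ for every $A\in\mathcal U$ and every pair of distinct nonempty subsets $J,K\subseteq\{1,2,3\}$. Consequently, every Pareto eigenvalue of a matrix in $\mathcal U$ has a unique producing support.
   Context: For $A\in\mathbb{R}^{n\times n}$ and a nonempty $J\subseteq\{1,\dots,n\}$ (called a support) with complement $J^{\mathrm c}$, $A_J$ is the principal submatrix of $A$ indexed by $J$, $A_{J^{\mathrm c},J}$ is the submatrix with rows in $J^{\mathrm c}$ and columns in $J$, and $\operatorname{spec}(M)$ is the set of complex eigenvalues of a square matrix $M$. Vector inequalities are componentwise ($u>0$ means all components are positive). A real number $\lambda$ is a Pareto eigenvalue of $A$ if there is $x\in\mathbb{R}^n\setminus\{0\}$ with $x\ge 0$, $Ax-\lambda x\ge 0$ and $\langle x,Ax-\lambda x\rangle=0$. The support $J$ produces $\lambda\in\mathbb{R}$ if there is $u\in\mathbb{R}^{|J|}$ with $A_Ju=\lambda u$, $u>0$, $A_{J^{\mathrm c},J}u\ge 0$; $\lambda$ is a Pareto eigenvalue of $A$ if and only if some support produces it. A Zariski-open subset of $\mathbb{R}^{3\times 3}$ is the complement of the common zero set of a family of real polynomials in the $9$ matrix entries. *)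

(* Defs.v *)
From HB Require Import structures.
From mathcomp Require Import all_boot all_order all_algebra.
From mathcomp Require Import all_classical all_reals all_analysis.
From mathcomp Require Import complex.
(* [mpoly] is not imported: its notations conflict with those of analysis. *)
From mathcomp Require mpoly.

Set Implicit Arguments.
Unset Strict Implicit.
Unset Printing Implicit Defensive.

Import Order.TTheory GRing.Theory Num.Theory numFieldNormedType.Exports.

Local Open Scope classical_set_scope.
Local Open Scope ring_scope.

Definition submx_of (R : Type) (n : nat) (A : 'M[R]_n) (I J : {set 'I_n}) :
    'M[R]_(#|I|, #|J|) :=
  mxsub (fun i : 'I_#|I| => enum_val i) (fun j : 'I_#|J| => enum_val j) A.

(* [eigenvalue] is phrased with row eigenvectors; for a square matrix over a
   field the left and right eigenvalues are the same. *)
Definition spec (R : realType) (n : nat) (M : 'M[R]_n) : set R[i] :=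
  [set z | eigenvalue (map_mx (real_complex R) M) z].

Definition pareto_eigenvalue (R : realType) (n : nat) (A : 'M[R]_n)
    (lambda : R) : Prop :=
  exists x : 'cV[R]_n,
    [/\ x != 0,
        forall i, 0 <= x i 0,
        forall i, 0 <= (A *m x - lambda *: x) i 0 &
        \sum_i x i 0 * (A *m x - lambda *: x) i 0 = 0].

Definition produces (R : realType) (n : nat) (A : 'M[R]_n)
    (J : {set 'I_n}) (lambda : R) : Prop :=
  J != finset.set0 /\
  exists u : 'cV[R]_#|J|,
    [/\ submx_of A J J *m u = lambda *: u,
        forall i, 0 < u i 0 &
        forall i, 0 <= (submx_of A (~: J) J *m u) i 0].

(* The variables of the polynomials are the matrix entries, in the order of
   [mxvec]. *)
Definition zariski_open (R : realType) (n : nat) (U : set 'M[R]_n) : Prop :=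
  exists F : set (mpoly.mpoly (n * n)%N R),
    U = ~` [set A | forall p, F p ->
                    mpoly.meval (fun k => mxvec A 0 k) p = 0].

(* Main.v *)
(* For supports J <> K, the matrices A such that A_J and A_K have coprime
   characteristic polynomials form a Zariski-open set, the non-vanishing set of
   a resultant. A nonempty Zariski-open set is Euclidean-open and dense, since a
   polynomial that does not vanish identically on a line has finitely many zeros
   there; so the intersection over all pairs is again nonempty, and it suffices
   to exhibit one matrix for each pair. Given k in J but not in K, an arrow matrix
   centred at k works: A_K is diagonal, while the nonzero entries in row and
   column k keep the diagonal entries of A_K out of the spectrum of A_J. *)
Require Import Defs.
From HB Require Import structures.
From mathcomp Require Import all_boot all_order all_algebra.
From mathcomp Require Import all_classical all_reals all_analysis.
From mathcomp Require Import complex.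

Set Implicit Arguments.
Unset Strict Implicit.
Unset Printing Implicit Defensive.

Import Order.TTheory GRing.Theory Num.Theory numFieldNormedType.Exports.

Local Open Scope classical_set_scope.
Local Open Scope ring_scope.

(* Importing all of [mpoly] would clash with the notations of analysis. *)
Import (canonicals, coercions) mpoly.

(* [mxpoly.map_resultant] only covers morphisms whose source is a polynomial ring. *)
Lemma map_resultant_monic (aR rR : nzRingType) (f : {rmorphism aR -> rR})
    (p q : {poly aR}) : p \is monic -> q \is monic ->
  f (resultant p q) = resultant (map_poly f p) (map_poly f q).
Proof.
move=> /monicP p1 /monicP q1.
(* Monic polynomials keep their degree under [f], so both Sylvester matrices have the same size. *)
rewrite /resultant /Sylvester_mx !size_map_poly_id0 ?p1 ?q1 ?rmorph1 ?oner_neq0 //.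
rewrite -det_map_mx /= map_col_mx; congr (\det (col_mx _ _));
  by apply: map_lin1_mx => v; rewrite map_poly_rV rmorphM /= map_rVpoly.
Qed.

(** Reconciles the column eigenvectors of [produces] with the row eigenvectors of [eigenvalue]. *)
Lemma char_poly_trmx (R : comNzRingType) (n : nat) (A : 'M[R]_n) :
  char_poly A^T = char_poly A.
Proof.
rewrite /char_poly -[RHS]det_tr /char_poly_mx raddfB /= tr_scalar_mx.
by rewrite map_trmx.
Qed.

Lemma resultant_neq0 (R : idomainType) (p q : {poly R}) :
  p \is monic -> (resultant p q != 0) = coprimep p q.
Proof.
move=> /monic_neq0 p0; rewrite resultant_eq0 -leqNgt /coprimep eqn_leq.
by rewrite andb_idr // lt0n size_poly_eq0 gcdp_eq0 (negPf p0).
Qed.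

Lemma coprimep_prodr (R : fieldType) (I : Type) (r : seq I) (p : {poly R})
    (F : I -> {poly R}) :
  (forall i, coprimep p (F i)) -> coprimep p (\prod_(i <- r) F i).
Proof.
move=> pF; elim/big_ind: _ => //; first exact: coprimep1.
by move=> a b pa pb; rewrite coprimepMr pa.
Qed.

(** * Zariski-open sets of matrices: intersections, openness, density *)

Section zariski.
Variables (R : realType) (n : nat).
Implicit Types (U V : set 'M[R]_n) (p : mpoly.mpoly (n * n) R).

Definition mxeval (A : 'M[R]_n) p : R :=
  mpoly.meval (fun k => mxvec A 0 k) p.

Lemma zariski_openP U : zariski_open U <->
  exists F : set (mpoly.mpoly (n * n) R),
    forall A, U A <-> exists2 p, F p & mxeval A p != 0.
Proof.
split=> [[F ->]|[F UF]]; exists F.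
  move=> A; split=> [/existsNP[p /not_implyP[Fp /eqP p0]]|]; first by exists p.
  by move=> [p Fp /eqP p0] /(_ p Fp).
apply/seteqP; split=> A.
  by move=> /UF[p Fp /eqP p0] /(_ p Fp).
by move=> /existsNP[p /not_implyP[Fp /eqP p0]]; apply/UF; exists p.
Qed.

Lemma zariski_openT : zariski_open ([set: 'M[R]_n]).
Proof.
apply/zariski_openP; exists setT => A; split=> // _.
by exists 1 => //; rewrite /mxeval mpoly.meval1 oner_neq0.
Qed.

Lemma zariski_openI U V :
  zariski_open U -> zariski_open V -> zariski_open (U `&` V).
Proof.
move=> /zariski_openP[F UF] /zariski_openP[G VG]; apply/zariski_openP.
exists [set p | exists q r, [/\ F q, G r & p = q * r]] => A; split.
  move=> [/UF[q Fq q0] /VG[r Gr r0]]; exists (q * r); first by exists q, r.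
  by rewrite /mxeval mpoly.mevalM mulf_neq0.
move=> [_ [q [r [Fq Gr ->]]]].
rewrite /mxeval mpoly.mevalM mulf_eq0 negb_or => /andP[q0 r0].
by split; [apply/UF; exists q|apply/VG; exists r].
Qed.

Lemma continuous_mxeval p : continuous (mxeval^~ p).
Proof.
(* [continuous_big] takes the operation as a function on pairs. *)
have cD : continuous (fun x : R * R => x.1 + x.2).
  by move=> x; apply: cvgD; [exact: cvg_fst|exact: cvg_snd].
have cM : continuous (fun x : R * R => x.1 * x.2).
  by move=> x; apply: cvgM; [exact: cvg_fst|exact: cvg_snd].
have mxvec_cts k : continuous (fun A : 'M[R]_n => mxvec A 0 k).
  case/mxvec_indexP: k => i j.
  under eq_fun do rewrite mxvecE.
  exact: coord_continuous.
have exp_cts k d : continuous (fun A : 'M[R]_n => mxvec A 0 k ^+ d).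
  move=> A; exact: (continuous_comp (@mxvec_cts k A) (@exprn_continuous _ d _)).
have mon_cts (m : 'I_(n * n) -> nat) :
    continuous (fun A : 'M[R]_n => \prod_k mxvec A 0 k ^+ m k).
  exact: (@continuous_big R 'I_(n * n) *%R 1 xpredT cM 'M[R]_n
    (index_enum _) (fun k A => mxvec A 0 k ^+ m k) (fun k _ => @exp_cts k (m k))).
apply: (@continuous_big R _ +%R 0 xpredT cD 'M[R]_n (mpoly.msupp p)) => m _ A.
exact: (continuousM (@cst_continuous _ _ (mpoly.mcoeff m p) A) (@mon_cts _ A)).
Qed.

Lemma zariski_open_open U : zariski_open U -> open U.
Proof.
move=> /zariski_openP[F UF].
have -> : U = \bigcup_(p in F) (mxeval^~ p @^-1` [set x | x != 0]).
  by apply/seteqP; split=> A; [move=> /UF|move=> ?; apply/UF].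
apply: bigcup_open => p _; apply: open_comp; last exact: open_neq.
by move=> A _; exact: continuous_mxeval.
Qed.

Lemma mxeval_line p (A B : 'M[R]_n) :
  exists q : {poly R}, forall t, q.[t] = mxeval (A + t *: B) p.
Proof.
exists (\sum_(m <- mpoly.msupp p) (mpoly.mcoeff m p)%:P *
  \prod_k ((mxvec A 0 k)%:P + (mxvec B 0 k) *: 'X) ^+ m k) => t.
rewrite /mxeval mpoly.mevalE horner_sum; apply: eq_bigr => m _.
rewrite hornerM hornerC horner_prod; congr (_ * _); apply: eq_bigr => k _.
by rewrite horner_exp !hornerE linearD linearZ !mxE mulrC.
Qed.

Lemma zariski_open_dense U : zariski_open U -> U !=set0 -> dense U.
Proof.
move=> /zariski_openP[F UF] [B /UF[p Fp pB]] O [A OA] oO.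
(* Restrict [p] to the line from [A] (at 0) to [B] (at 1); [q] is nonzero because [q.[1]] is the
   value of [p] at [B]. *)
have [q qE] := mxeval_line p A (B - A).
have q0 : q != 0.
  apply: contraNneq pB => q0; have := qE 1.
  by rewrite q0 horner0 scale1r addrC subrK => <-.
have : \forall t \near (0 : R), O (A + t *: (B - A)).
  have c : (fun t : R => A + t *: (B - A)) t @[t --> (0 : R)] --> A.
    rewrite -[X in _ --> X]addr0 -(scale0r (B - A)).
    apply: cvgD; first exact: cvg_cst.
    by apply: cvgZ; [exact: cvg_id|exact: cvg_cst].
  by apply: c; apply: open_nbhs_nbhs.
move=> /nbhs_ballP[e e0 eO].
(* These are [size q] distinct points, more than [q] has roots. The shift [k.+2] puts them strictly
   inside the ball of radius [e]. *)
pose rs := [seq e / k.+2%:R | k <- iota 0 (size q)].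
have rs_uniq : uniq rs.
  rewrite map_inj_uniq ?iota_uniq// => i j /(mulfI (lt0r_neq0 e0))/invr_inj/eqP.
  by rewrite eqr_nat => /eqP[].
have : ~~ all (root q) rs.
  apply/negP => /(max_poly_roots q0)/(_ rs_uniq).
  by rewrite size_map size_iota ltnn.
move=> /allPn[t /mapP[k _ ->{t}] qt]; exists (A + (e / k.+2%:R) *: (B - A)).
split; last by apply/UF; exists p; rewrite // -qE.
apply: eO; rewrite /ball/= sub0r normrN gtr0_norm ?divr_gt0// ltr_pdivrMr//.
by rewrite ltr_pMr// ltr1n.
Qed.

End zariski.

(** * Coprime characteristic polynomials *)

Lemma map_submx_of (aR rR : Type) (f : aR -> rR) (n : nat) (I J : {set 'I_n})
    (A : 'M[aR]_n) :
  map_mx f (submx_of A I J) = submx_of (map_mx f A) I J.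
Proof. exact: map_mxsub. Qed.

Lemma zariski_open_coprimep (R : realType) (n : nat) (J K : {set 'I_n}) :
  zariski_open [set A : 'M[R]_n |
    coprimep (char_poly (submx_of A J J)) (char_poly (submx_of A K K))].
Proof.
(* The generic matrix, whose entries are the variables; evaluation at [A] specializes it to [A]. *)
pose X : 'M[mpoly.mpoly (n * n) R]_n :=
  \matrix_(i, j) mpoly.mpolyX R (mpoly.mnm1 (mxvec_index i j)).
apply/zariski_openP.
exists [set resultant (char_poly (submx_of X J J)) (char_poly (submx_of X K K))].
move=> A; pose f : {rmorphism _ -> _} := mpoly.meval (fun k => mxvec A 0 k).
have fX : map_mx f X = A.
  by apply/matrixP => i j; rewrite !mxE [LHS]mpoly.mevalXU mxvecE.
have fE : f (resultant (char_poly (submx_of X J J)) (char_poly (submx_of X K K)))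
    = resultant (char_poly (submx_of A J J)) (char_poly (submx_of A K K)).
  rewrite map_resultant_monic ?char_poly_monic//.
  by rewrite !map_char_poly !map_submx_of fX.
rewrite /= -(resultant_neq0 _ (char_poly_monic _)) -fE.
by split=> [f0|[_ -> //]]; exists (resultant (char_poly (submx_of X J J))
  (char_poly (submx_of X K K))).
Qed.

(** Coprimality over [R] persists over [R[i]], where it excludes a common root. *)
Lemma coprimep_spec (R : realType) (n m : nat) (A : 'M[R]_n) (B : 'M[R]_m) :
  coprimep (char_poly A) (char_poly B) -> spec A `&` spec B = set0.
Proof.
move=> AB; apply/seteqP; split=> // z [].
rewrite /spec /= !eigenvalue_root_char -!map_char_poly => Az Bz.
move: AB; rewrite -(coprimep_map (real_complex R)).
by move=> /coprimep_root/(_ Az)/negP.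
Qed.

(** * The arrow matrix separating two supports *)

Lemma big_submx_of (R : nzRingType) (n : nat) (J : {set 'I_n}) (F : 'I_n -> R) :
  \sum_(a < #|J|) F (enum_val a) = \sum_(j in J) F j.
Proof. by rewrite [RHS]big_enum_val. Qed.

Lemma submx_of_coprimep (R : realFieldType) (n : nat) (J K : {set 'I_n})
    (k : 'I_n) : k \in J -> k \notin K ->
  exists A : 'M[R]_n,
    coprimep (char_poly (submx_of A J J)) (char_poly (submx_of A K K)).
Proof.
move=> kJ kK.
(* Distinct negative values on [J], zero off [J]. *)
pose d (j : 'I_n) : R := if j \in J then - j.+1%:R else 0.
pose A := \matrix_(i, j) (if (i == k) || (j == k) then 1 else d i *+ (i == j)).
have nk i : i \in K -> (i == k) = false by apply: contraTF => /eqP ->.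
exists A; rewrite [char_poly (submx_of A K K)]char_poly_trig; last first.
  apply/is_trig_mxP => a b ab; rewrite !mxE !nk ?enum_valP//=.
  by rewrite (inj_eq enum_val_inj) -val_eqE /= ltn_eqF.
apply: coprimep_prodr => a; rewrite coprimep_XsubC -eigenvalue_root_char.
rewrite !mxE eqxx nk ?enum_valP//= mulr1n.
move: (enum_val a) (enum_valP a) => i iK; have ik := nk _ iK.
(* A row eigenvector [v] of [A_J] for [d i] must vanish; [x] is [v] reindexed by the elements of
   [J]. *)
apply/negP => /eigenvalueP[v vA /eqP v0]; apply: v0.
pose x j := v 0 (enum_rank_in kJ j).
have xE b : v 0 b = x (enum_val b) by rewrite /x enum_valK_in.
have eqn j : j \in J -> \sum_(l in J) x l * A l j = d i * x j.
  move=> jJ; move/rowP/(_ (enum_rank_in kJ j)): vA; rewrite !mxE => <-.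
  rewrite -big_submx_of; apply: eq_bigr => b _.
  by rewrite xE !mxE enum_rankK_in.
have eqk : \sum_(l in J) x l = d i * x k.
  by rewrite -eqn//; apply: eq_bigr => l _; rewrite mxE eqxx orbT mulr1.
have eqj j : j \in J -> j != k -> x k + x j * d j = d i * x j.
  move=> jJ jk; rewrite -eqn// (bigD1 k)//= (bigD1 j) ?jJ//=.
  rewrite !mxE eqxx mulr1 (negPf jk) eqxx/= mulr1n big1 ?addr0// => l.
  by rewrite !mxE => /andP[/andP[_ /negPf ->] /negPf ->]; rewrite (negPf jk) mulr0.
suff x0 j : j \in J -> x j = 0.
  by apply/rowP => b; rewrite xE mxE x0// enum_valP.
(* If [i] is in [J], equation [i] gives [x k = 0], distinctness of the [d j] kills every other entry
   except [x i], and equation [k] kills [x i]. *)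
have [iJ|iJ] := boolP (i \in J).
  have xk0 : x k = 0.
    have := eqj i iJ (negbT ik).
    by rewrite [x i * _]mulrC => /(canRL (addrK _)); rewrite subrr.
  have xj0 l : l \in J -> l != i -> x l = 0.
    move=> lJ li; have [->//|lk] := eqVneq l k.
    have := eqj l lJ lk; rewrite xk0 add0r mulrC => /eqP.
    rewrite -subr_eq0 -mulrBl mulf_eq0 => /orP[|/eqP//].
    by rewrite /d lJ iJ subr_eq0 eqr_opp eqr_nat eqSS val_eqE (negPf li).
  move=> jJ; have [->|] := eqVneq j i; last exact: xj0.
  move: eqk; rewrite xk0 mulr0 (bigD1 i)//= big1 ?addr0// => l /andP[]; exact: xj0.
(* If [i] is not in [J], every entry is a positive multiple of [x k], and equation [k] forces
   [x k = 0]. *)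
have di : d i = 0 by rewrite /d (negPf iJ).
have xj l : l \in J -> l != k -> x l = x k / l.+1%:R.
  move=> lJ lk; have := eqj l lJ lk; rewrite di mul0r /d lJ mulrN => /subr0_eq ->.
  by rewrite mulfK// pnatr_eq0.
have xk0 : x k = 0.
  (* [x k * (1 + \sum_l 1 / (l + 1)) = 0], where the sum is nonnegative *)
  move: eqk; rewrite di mul0r (bigD1 k)//=.
  under eq_bigr => l /andP[lJ lk] do rewrite xj//.
  rewrite -mulr_sumr -[X in X + _]mulr1 -mulrDr => /eqP.
  rewrite mulf_eq0 [1 + _ == 0]gt_eqF ?orbF => [/eqP//|].
  by rewrite ltr_wpDr// sumr_ge0// => l _; rewrite invr_ge0.
move=> jJ; have [->//|jk] := eqVneq j k.
by rewrite xj// xk0 mul0r.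
Qed.

(** * The generic set *)

Definition spectrally_generic (R : realType) (n : nat) : set 'M[R]_n :=
  \big[setI/setT]_(JK : {set 'I_n} * {set 'I_n} | JK.1 != JK.2)
    [set A | coprimep (char_poly (submx_of A JK.1 JK.1))
                      (char_poly (submx_of A JK.2 JK.2))].

Lemma spectrally_genericP (R : realType) (n : nat) (A : 'M[R]_n)
    (J K : {set 'I_n}) : spectrally_generic A -> J != K ->
  coprimep (char_poly (submx_of A J J)) (char_poly (submx_of A K K)).
Proof.
by move=> + JK; rewrite /spectrally_generic (bigD1 (J, K))// => -[].
Qed.

Lemma spectrally_generic_zariski_open_dense (R : realType) (n : nat) :
  zariski_open (@spectrally_generic R n) /\ dense (@spectrally_generic R n).
Proof.
rewrite /spectrally_generic.
(* Both properties are carried together: density of an intersection uses that one of the sets is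
   open. *)
apply: (@big_ind _ (fun U : set 'M[R]_n => zariski_open U /\ dense U)).
- by split; [exact: zariski_openT|move=> O O0 _; rewrite setIT].
- move=> U V [zU dU] [zV dV]; split; first exact: zariski_openI.
  by apply: denseI => //; exact: zariski_open_open.
move=> [J K] /= JK; split; first exact: zariski_open_coprimep.
apply: zariski_open_dense; first exact: zariski_open_coprimep.
move: JK; rewrite finset.eqEsubset negb_and => /orP[]/subsetPn[k kJ kK].
  exact: submx_of_coprimep kJ kK.
have [A AKJ] := @submx_of_coprimep R n K J k kJ kK.
by exists A; rewrite /= coprimep_sym.
Qed.

(** * Pareto eigenvalues and their supports *)

Lemma produces_root (R : realType) (n : nat) (A : 'M[R]_n) (J : {set 'I_n})
    (lambda : R) : produces A J lambda ->
  root (char_poly (submx_of A J J)) lambda.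
Proof.
move=> [/set0Pn[j jJ] [u [Au u0 _]]].
rewrite -char_poly_trmx -eigenvalue_root_char; apply/eigenvalueP.
exists u^T; first by rewrite -trmx_mul Au linearZ.
apply/eqP => /matrixP/(_ 0 (enum_rank_in jJ j)); rewrite !mxE => uj0.
by have := u0 (enum_rank_in jJ j); rewrite uj0 ltxx.
Qed.

(** Take for [J] the support of [x]. Complementarity holds termwise, giving the eigenvalue equation
    where [x] is positive; where [x] vanishes, the inequality reduces to [A x >= 0]. *)
Lemma pareto_eigenvalue_produces (R : realType) (n : nat) (A : 'M[R]_n)
    (lambda : R) : pareto_eigenvalue A lambda ->
  exists J : {set 'I_n}, produces A J lambda.
Proof.
move=> [x [x0 x_ge0 y_ge0 xy0]].
have {}xy0 i : x i 0 * (A *m x - lambda *: x) i 0 = 0.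
  apply: (psumr_eq0P _ xy0) => // l _; exact: mulr_ge0.
pose J := [set i | 0 < x i 0]%SET.
have xJ i : i \notin J -> x i 0 = 0.
  by rewrite finset.inE -leNgt => xi; apply/eqP; rewrite eq_le xi x_ge0.
pose u : 'cV[R]_#|J| := \col_a x (enum_val a) 0.
have Ju (I : {set 'I_n}) a : (submx_of A I J *m u) a 0 = (A *m x) (enum_val a) 0.
  rewrite !mxE (bigID (mem J))/= [X in _ = _ + X]big1 ?addr0 => [|i /xJ ->].
    by rewrite -big_submx_of; apply: eq_bigr => b _; rewrite !mxE.
  by rewrite mulr0.
exists J; split.
  apply: contraNneq x0 => J0; apply/eqP/matrixP => i j; rewrite ord1 mxE.
  by rewrite xJ// J0 finset.inE.
exists u; split.
- apply/matrixP => a j; rewrite ord1 Ju.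
  have := enum_valP a; rewrite finset.inE => /lt0r_neq0 xa.
  have /eqP := xy0 (enum_val a); rewrite mulf_eq0 (negPf xa)/= !mxE subr_eq0.
  by move/eqP ->.
- by move=> a; rewrite mxE; have := enum_valP a; rewrite finset.inE.
move=> a; rewrite Ju; have := enum_valP a; rewrite finset.in_setC => /xJ xa.
by have := y_ge0 (enum_val a); rewrite !mxE xa mulr0 subr0.
Qed.

Theorem proposition7p3 (R : realType) :
  exists U : set 'M[R]_3,
    [/\ U !=set0, zariski_open U, open U & dense U] /\
    (forall A : 'M[R]_3, U A ->
       forall J K : {set 'I_3},
         J != finset.set0 -> K != finset.set0 -> J != K ->
         spec (submx_of A J J) `&` spec (submx_of A K K) = set0) /\
    (forall A : 'M[R]_3, U A ->
       forall lambda : R, pareto_eigenvalue A lambda ->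
         exists! J : {set 'I_3}, produces A J lambda).
Proof.
have [zU dU] := spectrally_generic_zariski_open_dense R 3.
exists (@spectrally_generic R 3); split; [split|split] => //.
(* A dense set meets the whole space. *)
- by rewrite -[X in X !=set0]setTI; apply: dU; [exists 0|exact: openT].
- exact: zariski_open_open.
- by move=> A UA J K _ _ JK; exact/coprimep_spec/spectrally_genericP.
move=> A UA lambda /pareto_eigenvalue_produces[J AJ].
exists J; split=> // K AK; apply/eqP/negPn/negP => JK.
(* Two producing supports would make [lambda] a common root of coprime polynomials. *)
have := coprimep_root (spectrally_genericP UA JK) (produces_root AJ).
by move=> /negP; apply; exact: produces_root AK.
Qed.
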